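(* For every integer $\Delta\ge4$, one has $A_\Delta=+\infty$, where \[ A_\Delta=\sup\{\tau_D(G)-\mathsf{B}_{\mathrm{HY}}(G): G \text{ is a connected graph with } \Delta(G)=\Delta\}, \] the supremum being taken in the extended reals.
   Context: All graphs are finite, simple and undirected. $\Delta(G)$ denotes the maximum degree of $G$. A set $T\subseteq V(G)$ is an identifying vertex cover if $e\cap T\neq\emptyset$ for every $e\in E(G)$ and the sets $e\cap T$ ($e\in E(G)$) are pairwise distinct; $\tau_D(G)$ is the minimum cardinality of an identifying vertex cover of $G$. For a graph $G$ of order $n$, size $m$ and maximum degree $\Delta$, \[ \mathsf{B}_{\mathrm{HY}}(G)=\frac{\Delta(\Delta-1)n+2m}{\Delta^2+1}. \] *)

(* Defs.v *)
(* MathComp and MathComp-Analysis. The latter is required only after the graph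
   section, since its classical sets reuse the notations of finset. *)
From HB Require Import structures.
From mathcomp Require Import all_boot all_order all_algebra.

Set Implicit Arguments.
Unset Strict Implicit.
Unset Printing Implicit Defensive.

Record sgraph := SGraph {
  vertex :> finType;
  adj : rel vertex;
  adj_sym : symmetric adj;
  adj_irrefl : irreflexive adj }.

Section Graph.
Variable G : sgraph.

(* Each edge is the two-element set of its endpoints, hence is counted once. *)
Definition edges : {set {set G}} :=
  [set e : {set G} | [exists x, exists y, adj x y && (e == [set x; y])]].

Definition graph_order : nat := #|G|.

Definition graph_size : nat := #|edges|.

Definition degree (x : G) : nat := #|[set y | adj x y]|.

Definition max_degree : nat := \max_(x : G) degree x.

Definition connected_graph : Prop :=
  (0 < #|G|)%N /\ forall x y : G, connect (@adj G) x y.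

Definition ident_vertex_cover (T : {set G}) : bool :=
  [forall e in edges, e :&: T != set0] &&
  [forall e in edges, forall f in edges, (e != f) ==> (e :&: T != f :&: T)].

(* The default value [set: G] of the arg min is itself an identifying vertex
   cover, see ident_vertex_coverT. *)
Definition tauD : nat :=
  #|[arg min_(T < [set: G] | ident_vertex_cover T) #|T|]|.

Lemma ident_vertex_coverT : ident_vertex_cover [set: G].
Proof.
apply/andP; split.
  apply/forall_inP => e; rewrite inE => /existsP[x /existsP[y /andP[_ /eqP->]]].
  by rewrite setIT; apply/set0Pn; exists x; rewrite !inE eqxx.
apply/forall_inP => e _; apply/forall_inP => f _; apply/implyP.
by rewrite !setIT.
Qed.

Lemma tauD_min (T : {set G}) : ident_vertex_cover T -> tauD <= #|T|.
Proof.
by rewrite /tauD; case: arg_minnP => [|S _ minS /minS]; first exact: ident_vertex_coverT.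
Qed.

Lemma tauD_attained : exists2 T, ident_vertex_cover T & #|T| = tauD.
Proof.
rewrite /tauD; case: arg_minnP => [|S coverS _]; first exact: ident_vertex_coverT.
by exists S.
Qed.

End Graph.

From mathcomp Require Import all_classical all_reals all_analysis.

Local Open Scope ring_scope.

Definition BHY (R : realType) (G : sgraph) : R :=
  let D := (max_degree G)%:R : R in
  (D * (D - 1) * (graph_order G)%:R + 2 * (graph_size G)%:R) / (D ^+ 2 + 1).

(* An existential rather than an image set: sgraph lives in too large a universe
   to be the argument of set. *)
Definition ADelta (R : realType) (D : nat) : \bar R :=
  ereal_sup [set x : \bar R | exists G : sgraph,
    [/\ connected_graph G, max_degree G = D
      & x = ((tauD G)%:R - BHY R G)%:E]]%classic.

(* Main.v *)
(* The complement of a minimum identifying vertex cover is a maximum 2-packing, so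
   [tauD G] is the order minus the packing number. If [G] has [n] vertices, [m]
   edges and splits into [k] blocks of diameter at most 2, then
   [tauD G - BHY G >= ((D + 1) n - 2 m) / (D^2 + 1) - k]. The blocks are copies of
   one graph: the Petersen graph, seen as the affine plane of order 2 (4 points,
   6 lines, points joined to the lines through them, parallel lines adjacent), in
   which each point is replaced by floor((D - 1) / 2) copies. Its surplus
   [(D + 1) n - 2 m - (D^2 + 1)] is (D - 3)^2 for odd D and (D - 4)^2 + 3 for even
   D, hence at least 3, while an edge joining two copies costs only 2. *)
Require Import Defs.
From mathcomp Require Import all_boot all_order all_algebra.
From mathcomp Require Import zify.

Set Implicit Arguments.
Unset Strict Implicit.
Unset Printing Implicit Defensive.

(** * Degree sums and the number of edges *)

Lemma degreeE (G : sgraph) (x : G) : degree x = \sum_(y : G) adj x y.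
Proof. by rewrite /degree -sum1_card big_mkcond; apply: eq_bigr => y _; rewrite inE; case: adj. Qed.

(** Each edge comes from the two distinct arcs [(x, y)] and [(y, x)]. An upper bound on the size
    suffices, since the size enters [BHY] positively. *)
Lemma handshake_leq (G : sgraph) : 2 * graph_size G <= \sum_(x : G) degree x.
Proof.
have -> : \sum_(x : G) degree x = \sum_(p : G * G | adj p.1 p.2) 1.
  rewrite [RHS]big_mkcond -(pair_bigA _ (fun x y => if adj x y then 1 else 0)) /=.
  apply: eq_bigr => x _; rewrite degreeE.
  by apply: eq_bigr => y _; case: adj.
rewrite (partition_big (fun p => [set p.1; p.2]) (mem (edges G))) /=; last first.
  move=> [x y] /= xy; rewrite inE; apply/existsP; exists x.
  by apply/existsP; exists y; rewrite xy eqxx.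
rewrite /graph_size mulnC -sum_nat_const.
apply: leq_sum => e; rewrite inE => /existsP[x /existsP[y /andP[xy /eqP->]]].
have neq : (x, y) != (y, x).
  by apply: contraTneq xy => -[-> _]; rewrite adj_irrefl.
rewrite (bigD1 (x, y)) /= ?xy ?eqxx //.
rewrite (bigD1 (y, x)) /=; last by rewrite adj_sym xy setUC eqxx /= eq_sym.
by [].
Qed.

(** * Complements of identifying vertex covers as 2-packings *)

Definition near_in (G : sgraph) (x y : G) : Prop :=
  adj x y \/ exists2 z, adj x z & adj z y.

(** An edge with an endpoint outside [T] has only its other endpoint as trace. So an edge [xy] would
    be uncovered, and on a path [x z y] both edges would have trace [[set z]]. *)
Lemma ident_vertex_cover_near (G : sgraph) (T : {set G}) (x y : G) :
  ident_vertex_cover T -> x \notin T -> y \notin T -> near_in x y -> x = y.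
Proof.
case/andP=> /forall_inP cov /forall_inP inj xT yT.
have edgeP u v : adj u v -> [set u; v] \in edges G.
  move=> uv; rewrite inE; apply/existsP; exists u.
  by apply/existsP; exists v; rewrite uv eqxx.
have trace u v : u \notin T -> adj u v -> [set u; v] :&: T = [set v].
  move=> uT uv; have /set0Pn[w] := cov _ (edgeP _ _ uv).
  rewrite !inE => /andP[/orP[]/eqP-> wT]; first by rewrite wT in uT.
  apply/setP=> t; rewrite !inE.
  case: (t =P u) => [->|_] /=; last by case: eqP => // ->.
  by rewrite (negbTE uT); apply/esym; apply: contraNF uT => /eqP->.
case=> [xy|[z xz zy]].
  have /setP/(_ y) := trace x y xT xy.
  by rewrite !inE eqxx orbT (negbTE yT).
rewrite adj_sym in zy.
have /forall_inP/(_ _ (edgeP _ _ zy)) := inj _ (edgeP _ _ xz).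
rewrite trace // trace // eqxx implybF negbK => /eqP/setP/(_ x).
rewrite !inE eqxx /= => /esym/orP[/eqP//|/eqP xz'].
by rewrite xz' adj_irrefl in xz.
Qed.

(** The fibres of [f] are the blocks; the complement of a minimum cover meets each in at most one
    vertex. *)
Lemma order_leq_tauD (G : sgraph) (B : finType) (f : G -> B) :
  (forall x y, x != y -> f x = f y -> near_in x y) ->
  graph_order G <= tauD G + #|B|.
Proof.
move=> near; have [T coverT <-] := tauD_attained G.
rewrite /graph_order -(cardsC T) leq_add2l.
rewrite -(card_in_imset (f := f)) ?max_card // => x y.
rewrite !inE => xT yT fxy; have [//|xy] := eqVneq x y.
exact: ident_vertex_cover_near coverT xT yT (near _ _ xy fxy).
Qed.

Lemma connect_near (G : sgraph) (x y : G) : near_in x y -> connect (@adj G) x y.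
Proof.
case=> [/connect1//|[z xz zy]]; exact: connect_trans (connect1 xz) (connect1 zy).
Qed.

(** * A tree of copies of a graph of diameter at most 2 *)

Section CopyTree.
Variables (H : sgraph) (a b : H) (c k : nat).
Hypotheses (ab : a != b) (c_gt0 : 0 < c).
Hypothesis near_H : forall x y : H, x != y -> near_in x y.

(* Copy [i > 0] hangs from copy [i - c]; as the subtraction is truncated, copy 0
   has the [c] children 1, ..., c, and any other copy has at most one child. *)
Definition link (u v : H * 'I_k) : bool :=
  [&& u.1 == a, v.1 == b, 0 < u.2 & u.2 - c == v.2 :> nat].

Definition tree_adj (u v : H * 'I_k) : bool :=
  [|| (u.2 == v.2) && adj u.1 v.1, link u v | link v u].

Lemma tree_adj_sym : symmetric tree_adj.
Proof. by move=> u v; rewrite /tree_adj eq_sym adj_sym [link u v || _]orbC. Qed.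

Lemma tree_adj_irrefl : irreflexive tree_adj.
Proof.
move=> u; rewrite /tree_adj adj_irrefl andbF orbb /=.
by apply/negP => /and4P[/eqP-> ]; rewrite (negbTE ab).
Qed.

Definition copy_tree : sgraph := SGraph tree_adj_sym tree_adj_irrefl.

(** The three kinds of adjacency exclude each other: [c > 0] makes a link change copy, and [a != b]
    prevents links in both directions. Degrees can thus be added up kind by kind. *)
Lemma tree_adj_split u v :
  tree_adj u v = ((u.2 == v.2) && adj u.1 v.1) + link u v + link v u :> nat.
Proof.
have same_copy x y : x.2 = y.2 -> link x y = false.
  move=> exy; rewrite /link exy.
  suff /negbTE-> : ~~ ((0 < y.2) && (y.2 - c == y.2)) by rewrite !andbF.
  by apply/andP => -[y0 /eqP yc]; move: c_gt0 y0 yc; clear; lia.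
have one_way : link u v -> link v u = false.
  by case/and4P=> /eqP ua _ _ _; rewrite /link ua (negbTE ab) andbF.
rewrite /tree_adj; case: (u.2 =P v.2) => [e|_] /=.
  by rewrite (same_copy _ _ e) (same_copy _ _ (esym e)) /= orbF !addn0.
by case: (link u v) one_way => //= ->.
Qed.

Definition children (i : 'I_k) : nat := \sum_(j < k) ((0 < j) && (j - c == i)).

Lemma sum_copy (x : H) (i : 'I_k) :
  \sum_(v : H * 'I_k) ((i == v.2) && adj x v.1) = degree x.
Proof.
rewrite -(pair_bigA _ (fun y j => ((i == j) && adj x y : nat))) degreeE /=.
apply: eq_bigr => y _; rewrite (bigD1 i) //= eqxx big1 ?addn0 // => j.
by rewrite eq_sym => /negbTE->.
Qed.

Lemma sum_link_in u : \sum_v link v u = (u.1 == b) * children u.2.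
Proof.
rewrite -(pair_bigA _ (fun y j => (link (y, j) u : nat))) /= (bigD1 a) //=.
rewrite [X in _ + X]big1 ?addn0 => [|y /negbTE ya].
  rewrite /link /= eqxx /children big_distrr /=; apply: eq_bigr => j _.
  by case: eqP; rewrite ?mul1n.
by apply: big1 => j _; rewrite /link /= ya.
Qed.

Lemma sum_link_out u : \sum_v link u v = (u.1 == a) && (0 < u.2).
Proof.
case: u => x i; rewrite -(pair_bigA _ (fun y j => (link (x, i) (y, j) : nat))) /=.
rewrite (bigD1 b) //= [X in _ + X]big1 ?addn0 => [|y /negbTE yb].
  have ltk : i - c < k by apply: leq_ltn_trans (leq_subr _ _) (ltn_ord i).
  rewrite (bigD1 (Ordinal ltk)) //= /link /= !eqxx /= andbT big1 ?addn0 // => j.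
  by rewrite -val_eqE /= eq_sym => /negbTE->; rewrite !andbF.
by apply: big1 => j _; rewrite /link /= yb andbF.
Qed.

Lemma degree_copy_tree (u : copy_tree) :
  degree u = degree u.1 + ((u.1 == a) && (0 < u.2)) + (u.1 == b) * children u.2.
Proof.
rewrite degreeE -sum_link_out -sum_link_in -(sum_copy u.1 u.2) -!big_split /=.
by apply: eq_bigr => v _; exact: tree_adj_split.
Qed.

(** From [0 < j] and [j - c = i] follows [i < j <= i + c], a window of [c] indices. *)
Lemma children_leq i : children i <= c.
Proof.
have -> : children i = size [seq j <- iota 0 k | (0 < j) && (j - c == i)].
  rewrite size_filter -sum1_count [RHS]big_mkcond /children /=.
  rewrite -(big_mkord xpredT (fun j => ((0 < j) && (j - c == i) : nat))).
  by rewrite /index_iota subn0; apply: eq_bigr => j _; case: andb.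
rewrite -[leqRHS](size_iota i.+1 c); apply: uniq_leq_size.
  by rewrite filter_uniq ?iota_uniq.
by move=> j; rewrite mem_filter !mem_iota; lia.
Qed.

Lemma children0 (i : 'I_k) : i = 0 :> nat -> c < k -> children i = c.
Proof.
move=> i0 ck; apply/eqP; rewrite eqn_leq children_leq /children i0 /=.
rewrite -(big_mkord xpredT (fun j => ((0 < j) && (j - c == 0) : nat))).
(* Each of the indices 1, ..., [c] contributes 1; the later ones are dropped. *)
rewrite (big_cat_nat (n := c.+1)) //= (big_nat_recl c) //=.
rewrite add0n; apply: leq_trans (leq_addr _ _).
rewrite -[leqLHS](subn0 c) -[leqLHS]muln1 -sum_nat_const_nat.
rewrite big_nat [leqRHS]big_nat; apply: leq_sum => j /andP[_ jc].
by rewrite subn_eq0 jc.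
Qed.

(** A vertex [a] gains at most one edge and a vertex [b] at most [c], with equality for [b] in copy
    0. *)
Lemma max_degree_copy_tree (D : nat) :
  max_degree H <= D -> degree a < D -> degree b + c = D -> c < k ->
  max_degree copy_tree = D.
Proof.
move=> HD aD bD ck; apply/eqP; rewrite eqn_leq; apply/andP; split.
  apply/bigmax_leqP => -[x i] _; rewrite degree_copy_tree /=.
  have [->|xa] := eqVneq x a; first by rewrite (negbTE ab); lia.
  have [->|xb] := eqVneq x b; first by have := children_leq i; lia.
  by rewrite !addn0; apply: leq_trans HD; exact: leq_bigmax.
have k_gt0 : 0 < k by apply: leq_ltn_trans ck.
apply: leq_trans (leq_bigmax ((b, Ordinal k_gt0) : copy_tree)).
by rewrite degree_copy_tree /= eqxx eq_sym (negbTE ab) children0 // addn0 mul1n bD.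
Qed.

Lemma near_copy (u v : copy_tree) : u != v -> u.2 = v.2 -> near_in u v.
Proof.
case: u v => [x i] [y j] /= neq eij; subst j.
have {neq} : x != y by apply: contraNneq neq => ->.
case/near_H=> [xy|[z xz zy]]; [left|right; exists (z, i)];
  by rewrite /= /tree_adj /= eqxx ?xy ?xz ?zy.
Qed.

Lemma connected_copy_tree : 0 < k -> connected_graph copy_tree.
Proof.
move=> k_gt0; pose root : copy_tree := (a, Ordinal k_gt0).
have csym := sym_connect_sym (@adj_sym copy_tree).
have copyC (u v : copy_tree) : u.2 = v.2 -> connect (@adj copy_tree) u v.
  by have [->|uv] := eqVneq u v => // /(near_copy uv); exact: connect_near.
(* Induction on a bound for the copy index: go to [a] within the copy, then along its link to the
   parent, whose index is smaller as [c > 0]. *)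
suff toroot n (u : copy_tree) : u.2 <= n -> connect (@adj copy_tree) u root.
  split; first by apply/card_gt0P; exists root.
  move=> u v; apply: connect_trans (toroot _ u (leqnn _)) _.
  by rewrite csym; exact: toroot (leqnn _).
elim: n u => [|n IHn] [x i] /= lein.
  by apply: copyC; apply: val_inj; rewrite /=; lia.
have [i0|i_gt0] := posnP i; first by apply: IHn; rewrite /= i0.
have ltk : i - c < k by apply: leq_ltn_trans (leq_subr _ _) (ltn_ord i).
apply: connect_trans (_ : connect _ _ ((a, i) : copy_tree)) _; first exact: copyC.
apply: connect_trans (_ : connect _ _ ((b, Ordinal ltk) : copy_tree)) _.
  by apply: connect1; rewrite /= /tree_adj /link /= i_gt0 !eqxx orbT.
by apply: IHn => /=; lia.
Qed.

(** Each copy has at most one link to a parent, and this link counts 2 in the degree sum. *)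
Lemma size_copy_tree :
  2 * graph_size copy_tree <= k * (\sum_(x : H) degree x + 2).
Proof.
apply: leq_trans (handshake_leq _) _.
have sum_out : \sum_(u : H * 'I_k) \sum_v link u v <= k.
  rewrite (eq_bigr _ (fun u _ => sum_link_out u)).
  rewrite -(pair_bigA _ (fun x (i : 'I_k) => ((x == a) && (0 < i) : nat))) /=.
  rewrite (bigD1 a) //= [X in _ + X]big1 ?addn0 => [|x /negbTE->]; last exact: big1.
  rewrite -[leqRHS]card_ord -sum1_card; apply: leq_sum => i _.
  exact: leq_b1.
have -> : \sum_(u : copy_tree) degree u
    = k * (\sum_(x : H) degree x) + \sum_(u : H * 'I_k) \sum_v link u v
      + \sum_(u : H * 'I_k) \sum_v link v u.
  rewrite -[k in k * _]card_ord -sum_nat_const exchange_big.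
  rewrite pair_bigA -!big_split; apply: eq_bigr => u _ /=.
  by rewrite degree_copy_tree -sum_link_out -sum_link_in.
rewrite [X in _ + X <= _]exchange_big /= mulnDr -addnA leq_add2l muln2 -addnn.
exact: leq_add.
Qed.

(** The hypothesis says that the surplus of [H] over [D ^ 2 + 1] is at least 3. The link of a copy
    uses up 2, so each of the [k] copies still gains 1. *)
Lemma tauD_copy_tree (D : nat) :
  \sum_(x : H) degree x + D ^ 2 + 4 <= D.+1 * graph_order H ->
  D * (D - 1) * graph_order copy_tree + 2 * graph_size copy_tree + k
    <= tauD copy_tree * (D ^ 2 + 1).
Proof.
move=> gain; have size_le := size_copy_tree.
have := order_leq_tauD (f := fun u : copy_tree => u.2) near_copy.
rewrite card_ord; have -> : graph_order copy_tree = graph_order H * k.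
  by rewrite /graph_order /= card_prod card_ord.
move: (graph_size _) (tauD _) (graph_order H) gain size_le => m t h.
move: (\sum_ _ _) => S gain size_le order_le.
have : k * (S + D ^ 2 + 4) <= k * (D.+1 * h) by rewrite leq_mul2l gain orbT.
have : (h * k) * (D ^ 2 + 1) <= (t + k) * (D ^ 2 + 1) by rewrite leq_mul2r order_le orbT.
by case: D gain => [|D] gain; rewrite ?subn1 /=; nia.
Qed.

End CopyTree.

(** * The block: a Petersen graph with multiplied points *)

(* The affine plane of order 2 with each point replaced by [q.+1] copies: a point
   is joined to the lines through it, and a line to its parallel. *)
Section Plane.
Variable q : nat.

(** The three nonzero linear forms on the plane over the field with two elements, one per parallel
    class; the line [(f, d)] is where form [f] takes the value [d]. *)
Definition line_form (f : option bool) (p : bool * bool) : bool :=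
  if f is Some s then if s then p.1 else p.2 else p.1 (+) p.2.

Definition plane_vertex : finType :=
  (((bool * bool) * 'I_q.+1) + (option bool * bool))%type.

Definition plane_adj (u v : plane_vertex) : bool :=
  match u, v with
  | inl p, inr l | inr l, inl p => line_form l.1 p.1 == l.2
  | inr l, inr l' => (l.1 == l'.1) && (l.2 != l'.2)
  | inl _, inl _ => false
  end.

Lemma plane_adj_sym : symmetric plane_adj.
Proof. by move=> [p|l] [p'|l'] //=; rewrite eq_sym [l.2 == _]eq_sym. Qed.

Lemma plane_adj_irrefl : irreflexive plane_adj.
Proof. by move=> [p|l] //=; rewrite !eqxx. Qed.

Definition plane_graph : sgraph := SGraph plane_adj_sym plane_adj_irrefl.

(** Two points share a line, a point off a line lies on its parallel, and two lines are parallel or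
    meet. *)
Lemma near_plane (u v : plane_graph) : u != v -> near_in u v.
Proof.
case: u v => [[p s]|[f d]] [[p' s']|[f' d']] neq.
- right; have [f fE] : exists f, line_form f p = line_form f p'.
    by case: p p' {neq} => [[] []] [[] []];
      first [by exists None | by exists (Some true) | by exists (Some false)].
  by exists (inr (f, line_form f p)); rewrite /= ?fE eqxx.
- have [eq_pl|neq_pl] := eqVneq (line_form f' p) d'; first by left; rewrite /= eq_pl.
  by right; exists (inr (f', line_form f' p)); rewrite /= !eqxx.
- have [eq_pl|neq_pl] := eqVneq (line_form f p') d; first by left; rewrite /= eq_pl.
  by right; exists (inr (f, line_form f p')); rewrite /= !eqxx // eq_sym.
have [eq_f|neq_f] := eqVneq f f'.
  left; rewrite /= eq_f eqxx /=; apply: contraNneq neq => eq_d.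
  by rewrite eq_f eq_d.
right; have [p pf pf'] : exists2 p, line_form f p = d & line_form f' p = d'.
  by case: f f' d d' neq_f {neq} => [[]|] [[]|] [] [] //= _;
    first [by exists (true, true) | by exists (true, false)
          | by exists (false, true) | by exists (false, false)].
by exists (inl (p, ord0)); rewrite /= ?pf ?pf'.
Qed.

Lemma degree_point (p : (bool * bool) * 'I_q.+1) : degree (inl p : plane_graph) = 3.
Proof.
rewrite degreeE big_sumType /= big1 // add0n.
rewrite -(pair_bigA _ (fun f d => (line_form f p.1 == d : nat))) /=.
rewrite (eq_bigr (fun=> 1)) => [|f _]; last by rewrite big_bool; case: line_form.
by rewrite sum1_card card_option card_bool.
Qed.

Lemma degree_line (l : option bool * bool) :
  degree (inr l : plane_graph) = 2 * q.+1 + 1.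
Proof.
case: l => f d; rewrite degreeE big_sumType /=; congr (_ + _).
  rewrite -(pair_bigA _ (fun p (s : 'I_q.+1) => (line_form f p == d : nat))) /=.
  rewrite (eq_bigr (fun p => (line_form f p == d) * q.+1)) => [|p _]; last first.
    by rewrite sum_nat_const card_ord mulnC.
  rewrite -big_distrl -(pair_bigA _ (fun x y => (line_form f (x, y) == d : nat))) /=.
  by rewrite !big_bool /=; case: f d => [[]|] [].
rewrite -(pair_bigA _ (fun g e => ((f == g) && (d != e) : nat))) /= (bigD1 f) //=.
rewrite [X in _ + X]big1 => [|g]; last first.
  by rewrite eq_sym big_bool => /negbTE->.
by rewrite eqxx big_bool; case: d.
Qed.

Lemma order_plane : graph_order plane_graph = 4 * q.+1 + 6.
Proof. by rewrite /graph_order card_sum !card_prod card_option card_ord !card_bool. Qed.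

Lemma sum_degree_plane : \sum_(u : plane_graph) degree u = 24 * q.+1 + 6.
Proof.
rewrite big_sumType /= (eq_bigr _ (fun p _ => degree_point p)).
rewrite (eq_bigr _ (fun l _ => degree_line l)) !sum_nat_const.
by rewrite !card_prod card_option card_ord !card_bool; lia.
Qed.

End Plane.

(** * Choice of the parameters *)

Lemma exists_graph_tauD_large (D k : nat) : 4 <= D -> D <= k ->
  exists G : sgraph, [/\ connected_graph G, max_degree G = D
    & D * (D - 1) * graph_order G + 2 * graph_size G + k
        <= tauD G * (D ^ 2 + 1)].
Proof.
(* The largest [q] for which the line degree [2 * q.+1 + 1] is at most [D]. *)
move=> D4 Dk; pose q := (D - 3)./2; pose H := plane_graph q.
have Dq : D = 2 * q.+1 + 1 \/ D = 2 * q.+1 + 2 by rewrite /q; lia.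
(* Points have degree 3, so [D - 3] children raise [b] in copy 0 to degree exactly [D]; [D <= k]
   provides enough copies. *)
pose a : H := inl ((true, true), ord0); pose b : H := inl ((true, false), ord0).
have ab : a != b by [].
have c_gt0 : 0 < D - 3 by rewrite subn_gt0.
exists (copy_tree (D - 3) k ab); split.
- by apply: connected_copy_tree => //; [exact: near_plane | lia].
- apply: max_degree_copy_tree => //; rewrite ?degree_point; try lia.
  by apply/bigmax_leqP => -[p|l] _; rewrite ?degree_point ?degree_line; lia.
- apply: tauD_copy_tree => //; first exact: near_plane.
  rewrite sum_degree_plane order_plane; move: Dq D4; clear.
  (* The surplus is [(D - 3) ^ 2] with [D >= 5] in the odd case, and [(D - 4) ^ 2 + 3] in the even
     case. *)
  by case=> -> ?; nia.
Qed.

(* Passage to the supremum *)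
From mathcomp Require Import all_classical all_reals all_analysis.
Import Order.TTheory GRing.Theory Num.Theory.

Theorem theorem4p6 (R : realType) (D : nat) (hD : (4 <= D)%N) :
  ADelta R D = (+oo)%E.
Proof.
apply/eqyP => A A_gt0; pose n := (D ^ 2 + 1)%N.
(* The gap is at least [k / n], so [k >= A * n] is wanted; the summand [D] ensures [D <= k]. *)
pose k := (D + Num.bound (A * n%:R)%R)%N.
have [G [connG maxG tau_ge]] := exists_graph_tauD_large hD (leq_addr _ _ : (D <= k)%N).
apply: (@le_trans _ _ ((tauD G)%:R - BHY R G)%:E); last first.
  by apply: ereal_sup_ubound; exists G.
rewrite lee_fin /BHY maxG lerBrDr -lerBrDl.
have nE : (D%:R ^+ 2 + 1 = n%:R :> R)%R by rewrite /n natrD natrX.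
have n_gt0 : (0 < n%:R :> R)%R by rewrite ltr0n /n addn1.
rewrite nE ler_pdivrMr // mulrBl.
have {}tau_ge : (D%:R * (D%:R - 1) * (graph_order G)%:R + 2 * (graph_size G)%:R + k%:R
    <= (tauD G)%:R * n%:R :> R)%R.
  have -> : (D%:R - 1 = (D - 1)%N%:R :> R)%R by rewrite natrB //; lia.
  by rewrite -!natrM -!natrD ler_nat.
rewrite lerBrDr; apply: le_trans tau_ge; rewrite lerD2l.
apply: (@le_trans _ _ (Num.bound (A * n%:R)%R)%:R%R).
  by apply/ltW/archi_boundP; rewrite mulr_ge0 ?ltW.
by rewrite ler_nat /k leq_addl.
Qed.
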